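(* Let $\bar x$ belong to the feasible region $\Omega_V$ of the MPVC (see context) and assume that GGCQ is fulfilled at $\bar x$. Further assume that there is a partition $(\beta_1,\beta_2)$ of $I^{00}$ such that for every $(\mu^h,\mu^g,\mu^H,\mu^G)\in\mathcal N_{VC}$ the implication $$\big(\mu_i^G\leq 0,\ i\in\beta_1,\ \text{ and }\ \mu_i^G\geq 0,\ i\in\beta_2\big)\Longrightarrow\big(\mu_i^H\geq 0,\ i\in\beta_1,\ \text{ and }\ \mu^G_i=0,\ i\in\beta_2\big)$$ holds. Then $$\widehat N_{\Omega_V}(\bar x)=M^{\beta_1,\beta_2}_{VC}=\nabla F(\bar x)^T \widehat N_D(F(\bar x)).$$
   Context: For $\Gamma\subset\mathbb{R}^d$, $\bar z\in\Gamma$: $T_\Gamma(\bar z)=\{u\mid \exists t_k\searrow 0,\ u_k\to u:\ \bar z+t_ku_k\in\Gamma\ \forall k\}$, $\widehat N_\Gamma(\bar z)=(T_\Gamma(\bar z))^\circ$, where $K^\circ=\{z^*\mid \langle z^*,u\rangle\le 0\ \forall u\in K\}$. MPVC: minimize $f(x)$ subject to $h(x)=0$, $g(x)\le 0$, $H_i(x)\ge 0$, $G_i(x)H_i(x)\le 0$ ($i=1,\ldots,m_V$), with $f:\mathbb{R}^n\to\mathbb{R}$, $h:\mathbb{R}^n\to\mathbb{R}^{m_E}$, $g:\mathbb{R}^n\to\mathbb{R}^{m_I}$, $G,H:\mathbb{R}^n\to\mathbb{R}^{m_V}$ continuously differentiable. Its feasible set is $\Omega_V=\{x\mid F(x)\in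 D\}$ with $F(x)=(h(x),g(x),-H_1(x),G_1(x),\ldots,-H_{m_V}(x),G_{m_V}(x))$, $D=\{0\}^{m_E}\times\mathbb{R}_-^{m_I}\times D_V^{m_V}$, $D_V=\{(a,b)\in\mathbb{R}_-\times\mathbb{R}\mid ab\ge 0\}$. GGCQ at $\bar x$: $(T_{\Omega_V}(\bar x))^\circ=\{u\mid\nabla F(\bar x)u\in T_D(F(\bar x))\}^\circ$. Index sets: $I^g=\{i\mid g_i(\bar x)=0\}$; $I^{0-}=\{i\mid H_i(\bar x)=0>G_i(\bar x)\}$; $I^{00}=\{i\mid H_i(\bar x)=0=G_i(\bar x)\}$; $I^{0+}=\{i\mid H_i(\bar x)=0<G_i(\bar x)\}$; $I^{+0}=\{i\mid H_i(\bar x)>0=G_i(\bar x)\}$; $I^{+-}=\{i\mid H_i(\bar x)>0>G_i(\bar x)\}$. A partition $(\beta_1,\beta_2)$ of $I^{00}$ consists of two disjoint (possibly empty) sets with union $I^{00}$. Let \begin{align*} \mathcal R_{VC}=\{(\mu^h,\mu^g,\mu^H,\mu^G)\in\mathbb{R}^{m_E}\times\mathbb{R}^{m_I}\times\mathbb{R}^{m_V}\times\mathbb{R}^{m_V}\mid\ &\mu_i^g=0,\ i\notin I^g;\ \mu_i^H=0,\ i\notin I^{0-}\cup I^{00}\cup I^{0+};\\ &\mu_i^G=0,\ i\notin I^{+0}\cup I^{00}\}, \end{align*} $$\mathcal N_{VC}=\Big\{\mu\in\mathcal R_{VC}\ \Big|\ \sum_{i=1}^{m_E}\mu_i^h\nabla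 h_i(\bar x)+\sum_{i=1}^{m_I}\mu_i^g\nabla g_i(\bar x)+\sum_{i=1}^{m_V}(\mu_i^G\nabla G_i(\bar x)-\mu_i^H\nabla H_i(\bar x))=0\Big\}.$$ Let $\tilde N^{\beta_1,\beta_2}_{VC}$ be the set of all $(\lambda^h,\lambda^g,\lambda^H,\lambda^G)\in\mathcal R_{VC}$ for which there is $(\mu^h,\mu^g,\mu^H,\mu^G)\in\mathcal N_{VC}$ with $\lambda^g_i\ge\max\{\mu^g_i,0\}$, $i\in I^g$; $\lambda^H_i\ge\max\{\mu^H_i,0\}$, $i\in I^{0-}$; $\lambda^G_i\ge\max\{\mu^G_i,0\}$, $i\in I^{+0}$; $\lambda^H_i\ge\mu^H_i$ and $\mu^G_i\le\lambda^G_i=0$, $i\in\beta_1$; $\lambda^H_i\ge 0$ and $\lambda^G_i=\mu^G_i\ge 0$, $i\in\beta_2$. Finally $$M^{\beta_1,\beta_2}_{VC}=\Big\{\sum_{i=1}^{m_E}\lambda_i^h\nabla h_i(\bar x)+\sum_{i=1}^{m_I}\lambda_i^g\nabla g_i(\bar x)+\sum_{i=1}^{m_V}(\lambda_i^G\nabla G_i(\bar x)-\lambda_i^H\nabla H_i(\bar x))\ \Big|\ (\lambda^h,\lambda^g,\lambda^H,\lambda^G)\in\tilde N^{\beta_1,\beta_2}_{VC}\Big\}.$$ *)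

(* Defs.v *)
(* Points of R^n are row vectors 'rV[R]_n, so the
   library's Jacobian 'J f x acts on the right: the derivative of f at x along u
   is u *m 'J f x, and its transpose applied to w is w *m ('J f x)^T. *)
From HB Require Import structures.
From mathcomp Require Import all_boot all_order all_algebra.
From mathcomp Require Import all_classical all_reals all_analysis.

Set Implicit Arguments.
Unset Strict Implicit.
Unset Printing Implicit Defensive.
Import Order.TTheory GRing.Theory Num.Theory.
Import numFieldNormedType.Exports.
Local Open Scope classical_set_scope.
Local Open Scope ring_scope.

Section VariationalGeometry.
Context {R : realType} {n : nat}.
Implicit Types (C : set 'rV[R]_n) (z u v : 'rV[R]_n).

Definition inner u v : R := \sum_(i < n) u 0 i * v 0 i.

Definition polar C : set 'rV[R]_n :=
  [set v | forall u, C u -> inner v u <= 0].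

Definition tangent_cone C z : set 'rV[R]_n :=
  [set u | exists (t : nat -> R) (s : nat -> 'rV[R]_n),
     [/\ forall k, 0 < t k, t @ \oo --> 0, s @ \oo --> u
       & forall k, C (z + t k *: s k)]].

Definition regular_normal_cone C z : set 'rV[R]_n := polar (tangent_cone C z).

Definition gradient (f : 'rV[R]_n -> R) (x : 'rV[R]_n) : 'rV[R]_n :=
  \row_(j < n) 'D_(delta_mx 0 j) (f : 'rV[R]_n -> R^o) x.

(* The domain is finite-dimensional, so continuity of x |-> 'd f x for the
   operator norm is the same as continuity of x |-> 'd f x v for every v. *)
Definition continuously_differentiable (W : normedModType R)
    (f : 'rV[R]_n -> W) : Prop :=
  (forall x, differentiable f x) /\ (forall v, continuous (fun x => 'd f x v)).

End VariationalGeometry.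

Record mpvc (R : realType) (n mE mI mV : nat) := MPVC {
  obj : 'rV[R]_n -> R ;
  eqc : 'rV[R]_n -> 'rV[R]_mE ;
  ineqc : 'rV[R]_n -> 'rV[R]_mI ;
  vcG : 'rV[R]_n -> 'rV[R]_mV ;
  vcH : 'rV[R]_n -> 'rV[R]_mV ;
  obj_C1 : continuously_differentiable (obj : 'rV[R]_n -> R^o) ;
  eqc_C1 : continuously_differentiable eqc ;
  ineqc_C1 : continuously_differentiable ineqc ;
  vcG_C1 : continuously_differentiable vcG ;
  vcH_C1 : continuously_differentiable vcH }.

Record multiplier (R : realType) (mE mI mV : nat) := Multiplier {
  mult_h : 'rV[R]_mE ;
  mult_g : 'rV[R]_mI ;
  mult_H : 'rV[R]_mV ;
  mult_G : 'rV[R]_mV }.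

Section VanishingConstraints.
Context {R : realType} {n mE mI mV : nat} (P : mpvc R n mE mI mV).
Implicit Types (x : 'rV[R]_n).
Local Notation mult := (multiplier R mE mI mV).
Implicit Types (l mu : mult).

Local Notation h x i := (eqc P x 0 i).
Local Notation g x i := (ineqc P x 0 i).
Local Notation G x i := (vcG P x 0 i).
Local Notation H x i := (vcH P x 0 i).

(* mxvec is row-major, so the last block is (-H_1, G_1, ..., -H_mV, G_mV). *)
Definition mpvc_map x : 'rV[R]_(mE + (mI + mV * 2)) :=
  row_mx (eqc P x) (row_mx (ineqc P x)
    (mxvec (\matrix_(i < mV, j < 2) if j == 0 then - H x i else G x i))).

Definition DV : set (R * R) := [set p | p.1 <= 0 /\ 0 <= p.1 * p.2].

Definition mpvc_D : set 'rV[R]_(mE + (mI + mV * 2)) :=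
  [set z : 'rV_(mE + (mI + mV * 2)) | [/\ lsubmx z = 0,
               forall i, lsubmx (rsubmx z) 0 i <= 0
             & forall i, let w := vec_mx (rsubmx (rsubmx z)) in
                         DV (w i 0, w i 1)]].

Definition feasible : set 'rV[R]_n := [set x | mpvc_D (mpvc_map x)].

Lemma feasibleP x : feasible x <->
  [/\ forall i, h x i = 0, forall i, g x i <= 0, forall i, 0 <= H x i
    & forall i, G x i * H x i <= 0].
Proof.
rewrite /feasible /mpvc_D /mpvc_map /DV /=.
rewrite !(row_mxKl, row_mxKr) mxvecK; split=> [[h0 g0 d]|[h0 g0 H0 GH0]].
  split=> // i; first by rewrite h0 mxE.
    by have [] := d i; rewrite !mxE /= oppr_le0.
  by have [_] := d i; rewrite !mxE /= mulNr oppr_ge0 mulrC.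
split=> //; first by apply/rowP=> i; rewrite h0 mxE.
by move=> i; rewrite !mxE /= oppr_le0 mulNr oppr_ge0 mulrC.
Qed.

Definition linearized_cone x : set 'rV[R]_n :=
  [set u | tangent_cone mpvc_D (mpvc_map x) (u *m 'J mpvc_map x)].

Definition GGCQ x : Prop :=
  polar (tangent_cone feasible x) = polar (linearized_cone x).

Definition Ig x : {set 'I_mI} := [set i | g x i == 0]%SET.
Definition I0m x : {set 'I_mV} := [set i | (H x i == 0) && (G x i < 0)]%SET.
Definition I00 x : {set 'I_mV} := [set i | (H x i == 0) && (G x i == 0)]%SET.
Definition I0p x : {set 'I_mV} := [set i | (H x i == 0) && (0 < G x i)]%SET.
Definition Ip0 x : {set 'I_mV} := [set i | (0 < H x i) && (G x i == 0)]%SET.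

Definition partition_I00 x (beta1 beta2 : {set 'I_mV}) : Prop :=
  (beta1 :&: beta2)%SET = finset.set0 /\ (beta1 :|: beta2)%SET = I00 x.

Definition RVC x : set mult :=
  [set mu | [/\ forall i, i \notin Ig x -> mult_g mu 0 i = 0,
                forall i, i \notin (I0m x :|: I00 x :|: I0p x)%SET ->
                  mult_H mu 0 i = 0
              & forall i, i \notin (Ip0 x :|: I00 x)%SET ->
                  mult_G mu 0 i = 0]].

Definition gradient_comb x mu : 'rV[R]_n :=
  \sum_(i < mE) mult_h mu 0 i *: gradient (fun y => h y i) x
  + \sum_(i < mI) mult_g mu 0 i *: gradient (fun y => g y i) x
  + \sum_(i < mV) (mult_G mu 0 i *: gradient (fun y => G y i) x
                   - mult_H mu 0 i *: gradient (fun y => H y i) x).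

Definition NVC x : set mult := [set mu | RVC x mu /\ gradient_comb x mu = 0].

Definition NtildeVC x (beta1 beta2 : {set 'I_mV}) : set mult :=
  [set l | RVC x l /\ exists2 mu, NVC x mu &
    [/\ forall i, i \in Ig x ->
          Num.max (mult_g mu 0 i) 0 <= mult_g l 0 i,
        forall i, i \in I0m x ->
          Num.max (mult_H mu 0 i) 0 <= mult_H l 0 i,
        forall i, i \in Ip0 x ->
          Num.max (mult_G mu 0 i) 0 <= mult_G l 0 i,
        forall i, i \in beta1 ->
          [/\ mult_H mu 0 i <= mult_H l 0 i,
              mult_G mu 0 i <= mult_G l 0 i & mult_G l 0 i = 0]
      & forall i, i \in beta2 ->
          [/\ 0 <= mult_H l 0 i,
              mult_G l 0 i = mult_G mu 0 i & 0 <= mult_G mu 0 i]]].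

Definition MVC x (beta1 beta2 : {set 'I_mV}) : set 'rV[R]_n :=
  gradient_comb x @` NtildeVC x beta1 beta2.

End VanishingConstraints.

Arguments mpvc_D {R} mE mI mV.

(* Main.v *)
Require Import Defs.
From mathcomp Require Import all_boot all_order all_algebra.
From mathcomp Require Import all_classical all_reals all_analysis.
From mathcomp Require Import ring.
Import Order.TTheory GRing.Theory Num.Theory.
Import numFieldNormedType.Exports.
Local Open Scope classical_set_scope.
Local Open Scope ring_scope.

(** Let F be the constraint map, z = F x, J the Jacobian of F at x, D the target
    set, and L the linearized cone {u | u J in T_D(z)}.  GGCQ replaces the
    regular normal cone of the feasible set by the polar of L, so the claim is a
    cycle of inclusions between the polar of L, the set M of the partition
    (beta1, beta2), and the image of the regular normal cone of D under the
    transposed Jacobian.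

    From the polar of L to M.  The cone L is not convex: at a biactive index the
    tangent cone of D_V is D_V itself, the union of the line {0} x R and the
    quadrant R_- x R_-.  Choosing the line for the indices of one part b1 and
    the quadrant for those of the other part b2 selects a polyhedral cone inside
    L (tangent_mpvc_D), whose polar Farkas' lemma describes by multipliers
    (polar_linearized_cone).  A polar vector v of L is polar to the pieces of
    both (beta1, beta2) and (beta2, beta1), hence has two multiplier
    representations, l and k.  Their difference mu = l - k is annihilated by the
    gradients, so it lies in N_VC, and the sign conditions on l and on
    k = l - mu together are exactly those defining M.

    From M to the regular normal cone of D.  The signs that M imposes on mu are
    the premise of the assumed implication; its conclusion forces the
    multiplier l to satisfy l_H >= 0 = l_G at all biactive indices.  The linear
    functional of such an l is maximal over D near z at the point z, because
    each of its summands is, and such a functional is a regular normal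
    (regular_normal_of_local_max, regular_normal_mult_row).

    From the regular normal cone of D to the polar of L.  This is the adjunction
    between J and its transpose, inner_mulmx_tr. *)

Set Implicit Arguments.
Unset Strict Implicit.
Unset Printing Implicit Defensive.

(** * The inner product on row vectors *)

Section Inner.
Context {R : realType} {n : nat}.
Implicit Types (u v w : 'rV[R]_n).

Lemma innerE u v : inner u v = (u *m v^T) 0 0.
Proof. by rewrite mxE; apply: eq_bigr => i _; rewrite mxE. Qed.

Lemma innerC u v : inner u v = inner v u.
Proof. by apply: eq_bigr => i _; rewrite mulrC. Qed.

Lemma innerDl u v w : inner (u + v) w = inner u w + inner v w.
Proof. by rewrite !innerE mulmxDl mxE. Qed.

Lemma innerZl a u w : inner (a *: u) w = a * inner u w.
Proof. by rewrite !innerE -scalemxAl mxE. Qed.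

Lemma innerNl u w : inner (- u) w = - inner u w.
Proof. by rewrite -scaleN1r innerZl mulN1r. Qed.

Lemma innerDr w u v : inner w (u + v) = inner w u + inner w v.
Proof. by rewrite innerC innerDl !(innerC w). Qed.

Lemma innerZr a w u : inner w (a *: u) = a * inner w u.
Proof. by rewrite innerC innerZl innerC. Qed.

Lemma innerNr w u : inner w (- u) = - inner w u.
Proof. by rewrite innerC innerNl innerC. Qed.

Lemma cvg_inner w (s : nat -> 'rV[R]_n) u :
  s @ \oo --> u -> inner w (s k) @[k --> \oo] --> inner w u.
Proof.
move=> su; rewrite /inner; apply: cvg_big => [|i _]; first exact: add_continuous.
apply: cvgMl_tmp.
exact: (cvg_comp _ _ su (@coord_continuous _ _ _ 0 i u)).
Qed.

End Inner.

Lemma inner_mulmx_tr (R : realType) (n m : nat) (A : 'M[R]_(n, m)) w u :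
  inner (w *m A^T) u = inner w (u *m A).
Proof. by rewrite !innerE trmx_mul mulmxA. Qed.

(** * Farkas' lemma *)

Section Farkas.
Context {R : realType} {n : nat}.

(** Bartl's algebraic proof, by induction on the number of generators: if the
    generators in s do not suffice, some e is polar to them with <b, e> > 0, so
    <a i0, e> > 0.  Projecting all vectors along a i0 onto the hyperplane
    orthogonal to e eliminates a i0, and lifting the resulting combination back
    only adds a nonnegative multiple of a i0. *)
Lemma farkas (I : eqType) (s : seq I) (a : I -> 'rV[R]_n) (b : 'rV[R]_n) :
  uniq s ->
  (forall u, (forall i, i \in s -> inner (a i) u <= 0) -> inner b u <= 0) ->
  exists2 l : I -> R, (forall i, 0 <= l i) & b = \sum_(i <- s) l i *: a i.
Proof.
elim: s a b => [|i0 s IH] a b.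
  move=> _ ab; exists (fun=> 0) => //; rewrite big_nil; apply/rowP => j.
  have : inner b b <= 0 by exact: ab.
  rewrite /inner => bb; have bb0 : \sum_i b 0 i * b 0 i = 0.
    by apply/eqP; rewrite eq_le bb sumr_ge0// => i _; rewrite -expr2 sqr_ge0.
  have /eqP : b 0 j * b 0 j = 0.
    by apply: (psumr_eq0P _ bb0) => // i _; rewrite -expr2 sqr_ge0.
  by rewrite mulf_eq0 orbb mxE => /eqP.
move=> /= /andP[i0s us] ab.
have [/(IH a b us)[l l0 bE]|] := pselect (forall u,
    (forall i, i \in s -> inner (a i) u <= 0) -> inner b u <= 0).
  exists (fun i => if i == i0 then 0 else l i) => [i|]; first by case: ifP.
  rewrite big_cons eqxx scale0r add0r bE; apply: eq_big_seq => i si.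
  by case: eqP => // ii0; rewrite -ii0 si in i0s.
move=> /existsNP[e /not_implyP[ae /negP]]; rewrite -ltNge => be.
have a0e : 0 < inner (a i0) e.
  rewrite ltNge; apply/negP => a0e; have := be; rewrite ltNge => /negP; apply.
  by apply: ab => i; rewrite inE => /predU1P[->//|]; exact: ae.
pose c := inner (a i0) e.
have c0 : c != 0 by rewrite gt_eqF.
(* pr is adjoint to the projection of the test vector u along e onto the
   hyperplane orthogonal to a i0. *)
pose pr v := v - (inner v e / c) *: a i0.
have prE v u : inner (pr v) u = inner v (u - (inner (a i0) u / c) *: e).
  rewrite /pr innerDl innerNl innerZl innerDr innerNr innerZr.
  by ring.
have [|l l0 bE] := IH (fun i => pr (a i)) (pr b) us.
  move=> u au; rewrite prE; apply: ab => i; rewrite inE => /predU1P[->|si].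
    by rewrite -prE /pr divff// scale1r subrr -(scale0r 0) innerZl mul0r.
  by rewrite -prE; exact: au.
pose l' := (inner b e - \sum_(i <- s) l i * inner (a i) e) / c.
exists (fun i => if i == i0 then l' else l i) => [i|].
  case: ifP => // _; rewrite divr_ge0 ?(ltW a0e)// subr_ge0.
  apply: le_trans (ltW be); rewrite big_seq; apply: sumr_le0 => j sj.
  by rewrite mulr_ge0_le0 ?ae.
rewrite big_cons eqxx -[LHS](subrK ((inner b e / c) *: a i0)) -/(pr b) bE.
have -> : \sum_(i <- s) l i *: pr (a i) =
    \sum_(i <- s) l i *: a i - ((\sum_(i <- s) l i * inner (a i) e) / c) *: a i0.
  rewrite mulr_suml scaler_suml -sumrB; apply: eq_bigr => i _.
  by rewrite scalerBr scalerA mulrA.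
rewrite -addrA [X in _ + X]addrC -scalerBl -mulrBl addrC.
congr (_ + _); apply: eq_big_seq => i si.
by case: eqP => // ii0; rewrite -ii0 si in i0s.
Qed.

(** Two flags per generator cover all kinds of linear constraints: an equation
    sets both, a constraint that is absent sets none, and then the two sign
    conditions force the coefficient to vanish. *)
Lemma farkas_mixed (I : finType) (p q : pred I) (a : I -> 'rV[R]_n) b :
  (forall u, (forall i, p i -> inner (a i) u <= 0) ->
             (forall i, q i -> 0 <= inner (a i) u) -> inner b u <= 0) ->
  exists l : I -> R, [/\ forall i, ~~ q i -> 0 <= l i,
    forall i, ~~ p i -> l i <= 0 & b = \sum_i l i *: a i].
Proof.
move=> ab.
pose a' (ie : I * bool) := if ie.2 then if p ie.1 then a ie.1 else 0
                           else if q ie.1 then - a ie.1 else 0.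
have [|u au|l l0 bE] := @farkas _ (index_enum (I * bool)%type) a' b.
- exact: index_enum_uniq.
- apply: ab => i si.
    by have := au (i, true) (mem_index_enum _); rewrite /a' /= si.
  by have := au (i, false) (mem_index_enum _);
    rewrite /a' /= si innerNl oppr_le0.
exists (fun i => (if p i then l (i, true) else 0)
                 - (if q i then l (i, false) else 0)); split.
- by move=> i /negbTE->; rewrite subr0; case: ifP.
- by move=> i /negbTE->; rewrite sub0r oppr_le0; case: ifP.
rewrite bE; transitivity (\sum_i \sum_e l (i, e) *: a' (i, e)).
  by rewrite pair_bigA; apply: eq_bigr => -[].
apply: eq_bigr => i _; rewrite big_bool /a' /= scalerBl.
congr (_ + _); first by case: ifP => // _; rewrite scale0r scaler0.
by case: ifP => // _; rewrite ?scalerN// scale0r scaler0 oppr0.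
Qed.

End Farkas.

(** * Two criteria for tangents and regular normals *)

Section TangentAndNormal.
Context {R : realType} {n : nat}.
Implicit Types (C : set 'rV[R]_n) (z d w : 'rV[R]_n).

Lemma tangent_feasible_direction C z d :
  (\forall t \near 0^'+, C (z + t *: d)) -> tangent_cone C z d.
Proof.
move=> [e /= e0 Ce].
have tk0 k : 0 < e / 2 * harmonic k by rewrite mulr_gt0 ?divr_gt0// invr_gt0.
exists (fun k => e / 2 * harmonic k), (fun=> d); split=> //.
- by rewrite -(mulr0 (e / 2)); apply: cvgMl_tmp; exact: cvg_harmonic.
- exact: cvg_cst.
move=> k; apply: Ce; last exact: tk0.
rewrite /= sub0r normrN gtr0_norm; last exact: tk0.
rewrite -mulrA gtr_pMr//.
apply: (@le_lt_trans _ _ 2^-1); last by rewrite invf_lt1// ltr1n.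
by rewrite ler_piMr ?invr_ge0// invf_le1 ?ler1n.
Qed.

(** For z + t_k s_k in C the maximality gives t_k <w, s_k> <= 0 eventually, and
    the sign passes to the limit of s_k. *)
Lemma regular_normal_of_local_max C z w :
  (\forall y \near z, C y -> inner w y <= inner w z) ->
  regular_normal_cone C z w.
Proof.
move=> wmax d [t [s [t0 tcv0 scvd Czts]]].
apply: (cvgr_to_le (@cvg_inner _ _ w _ _ scvd)).
have zcv : z + t k *: s k @[k --> \oo] --> z.
  rewrite -[X in _ --> X]addr0 -(scale0r d).
  by apply: cvgD; [exact: cvg_cst|exact: cvgZ].
have : \forall k \near \oo, C (z + t k *: s k) ->
  inner w (z + t k *: s k) <= inner w z by exact: zcv wmax.
apply: filterS => k /(_ (Czts k)).
by rewrite innerDr innerZr gerDl pmulr_rle0.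
Qed.

End TangentAndNormal.

(** * Coordinates of the constraint space *)

Section Coordinates.
Context {mE mI mV : nat}.
Local Notation m := (mE + (mI + mV * 2))%N.

(** The positions, in the row of all constraints, of h_i, g_i, -H_i and G_i. *)
Definition ixh (i : 'I_mE) : 'I_m := lshift _ i.
Definition ixg (i : 'I_mI) : 'I_m := rshift mE (lshift _ i).
Definition ixH (i : 'I_mV) : 'I_m := rshift mE (rshift mI (mxvec_index i 0)).
Definition ixG (i : 'I_mV) : 'I_m := rshift mE (rshift mI (mxvec_index i 1)).

Variant ix_spec : 'I_m -> Type :=
| Ixh i : ix_spec (ixh i)
| Ixg i : ix_spec (ixg i)
| IxH i : ix_spec (ixH i)
| IxG i : ix_spec (ixG i).

Lemma ixP k : ix_spec k.
Proof.
case: (split_ordP k) => [i ->|k' ->]; first exact: Ixh.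
case: (split_ordP k') => [i ->|k'' ->]; first exact: Ixg.
case/mxvec_indexP: k'' => i j.
case: j => -[|[|//]] j2.
  by rewrite (_ : Ordinal j2 = 0); [exact: IxH|exact/val_inj].
by rewrite (_ : Ordinal j2 = 1); [exact: IxG|exact/val_inj].
Qed.

Lemma sum_ix (V : nmodType) (f : 'I_m -> V) :
  \sum_k f k = \sum_i f (ixh i) + \sum_i f (ixg i)
               + \sum_i (f (ixH i) + f (ixG i)).
Proof.
rewrite big_split_ord/= big_split_ord/= addrA; congr (_ + _).
rewrite (reindex _ (curry_mxvec_bij _ _)) /=.
transitivity (\sum_i \sum_j f (rshift mE (rshift mI (mxvec_index i j)))).
  by rewrite pair_bigA; apply: eq_bigr => -[].
apply: eq_bigr => i _; rewrite big_ord_recl big_ord1.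
by congr (_ + f (rshift _ (rshift _ (mxvec_index _ _)))); exact/val_inj.
Qed.

(** Arbitrary entries are allowed because the same layout serves for constraint
    values, for multipliers, and for the boolean flags given to Farkas' lemma. *)
Definition pack (T : Type) (h : 'I_mE -> T) (g : 'I_mI -> T)
    (H G : 'I_mV -> T) : 'rV[T]_m :=
  row_mx (\row_i h i) (row_mx (\row_i g i)
    (mxvec (\matrix_(i < mV, j < 2) if j == 0 then H i else G i))).

Section PackEntries.
Context (T : Type) (h : 'I_mE -> T) (g : 'I_mI -> T) (H G : 'I_mV -> T).

Lemma pack_h i : pack h g H G 0 (ixh i) = h i.
Proof. by rewrite row_mxEl mxE. Qed.

Lemma pack_g i : pack h g H G 0 (ixg i) = g i.
Proof. by rewrite row_mxEr row_mxEl mxE. Qed.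

Lemma pack_H i : pack h g H G 0 (ixH i) = H i.
Proof. by rewrite !row_mxEr mxvecE mxE. Qed.

Lemma pack_G i : pack h g H G 0 (ixG i) = G i.
Proof. by rewrite !row_mxEr mxvecE mxE. Qed.

End PackEntries.

Definition packE := (pack_h, pack_g, pack_H, pack_G).

Lemma mpvc_D_E (R : realType) (z : 'rV[R]_m) : mpvc_D mE mI mV z <->
  [/\ forall i, z 0 (ixh i) = 0, forall i, z 0 (ixg i) <= 0
    & forall i, DV (z 0 (ixH i), z 0 (ixG i))].
Proof.
rewrite /mpvc_D /=; split=> [[h0 g0 d]|[h0 g0 d]]; split.
- by move=> i; have /rowP/(_ i) := h0; rewrite !mxE.
- by move=> i; have := g0 i; rewrite !mxE.
- by move=> i; have := d i; rewrite /= !mxE.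
- by apply/rowP => i; rewrite !mxE; exact: h0.
- by move=> i; rewrite !mxE; exact: g0.
- by move=> i; rewrite /= !mxE; exact: d.
Qed.

End Coordinates.

(** * Jacobians and gradients *)

Section Derivatives.
Context {R : realType} {n : nat}.

Lemma differentiable_rV m (f : 'rV[R]_n -> 'rV[R]_m) x :
  (forall k, differentiable (fun y => f y 0 k : R^o) x) -> differentiable f x.
Proof.
move=> df; have -> : f = \sum_k (fun y => f y 0 k *: delta_mx 0 k).
  by apply/funext => y; rewrite fct_sumE; exact: row_sum_delta.
by apply: differentiable_sum => k; apply: differentiableZl; exact: df.
Qed.

Lemma differentiable_entry m (f : 'rV[R]_n -> 'rV[R]_m) x k :
  differentiable f x -> differentiable (fun y => f y 0 k : R^o) x.
Proof.
move=> df; apply: (@differentiable_comp _ _ _ _ f (fun M => M 0 k : R^o)) => //.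
exact: differentiable_coord.
Qed.

Lemma jacobianE m (f : 'rV[R]_n -> 'rV[R]_m) x j k : differentiable f x ->
  'J f x j k = gradient (fun y => f y 0 k) x 0 j.
Proof.
move=> df; have := deriveEjacobian (delta_mx 0 j) df.
rewrite -rowE derive_mx; last exact: diff_derivable.
by move=> /rowP/(_ k); rewrite !mxE.
Qed.

Lemma gradientN (f : 'rV[R]_n -> R) x : differentiable (f : _ -> R^o) x ->
  gradient (fun y => - f y) x = - gradient f x.
Proof.
move=> df; apply/rowP => j; rewrite !mxE.
exact: (@deriveN _ _ _ f x (delta_mx 0 j) (diff_derivable df)).
Qed.

End Derivatives.

(** * Strict signs persist nearby *)

Section NearCoordinates.
Context {R : realType} {m : nat}.

(** Inactive constraints stay inactive: this makes D coincide near a point with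
    a set described by the active constraints only. *)
Lemma near_coord_sign (z : 'rV[R]_m) : \forall y \near z,
  forall k, (z 0 k < 0 -> (y : 'rV[R]_m) 0 k < 0) /\ (0 < z 0 k -> 0 < y 0 k).
Proof.
apply: (@filter_forall _ _ (fun k (y : 'rV[R]_m) =>
  (z 0 k < 0 -> y 0 k < 0) /\ (0 < z 0 k -> 0 < y 0 k)) (nbhs z) _) => k.
have zk : (fun y : 'rV[R]_m => y 0 k) @ z --> z 0 k by exact: coord_continuous.
case: (ltgtP (z 0 k) 0) => zk0.
- by apply: filterS (cvgr_lt _ zk _ zk0) => y ?; split.
- by apply: filterS (cvgr_gt _ zk _ zk0) => y ?; split.
- by apply: nearW => y; split.
Qed.

Lemma near_ray_sign (z d : 'rV[R]_m) : \forall t \near 0^'+,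
  forall k, (z 0 k < 0 -> (z + t *: d) 0 k < 0) /\
            (0 < z 0 k -> 0 < (z + t *: d) 0 k).
Proof.
have zt : (fun t : R => z + t *: d) @ 0^'+ --> z.
  rewrite -[X in _ --> X]addr0 -(scale0r d).
  apply: cvgD; first exact: cvg_cst.
  by apply: cvgZr_tmp; apply: cvg_at_right_filter; exact: cvg_id.
exact: zt (near_coord_sign z).
Qed.

End NearCoordinates.

(** * Vanishing constraints at a feasible point *)

Section Mpvc.
Context {R : realType} {n mE mI mV : nat} (P : mpvc R n mE mI mV).
Context (x : 'rV[R]_n).
Local Notation F := (mpvc_map P).
Local Notation mult := (multiplier R mE mI mV).
Implicit Types (l mu : mult) (u v : 'rV[R]_n).

Lemma mpvc_map_pack y : F y =
  pack (eqc P y 0) (ineqc P y 0) (fun i => - vcH P y 0 i) (vcG P y 0).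
Proof.
rewrite /mpvc_map; congr (row_mx _ (row_mx _ _)).
- by apply/rowP => i; rewrite mxE.
- by apply/rowP => i; rewrite mxE.
Qed.

Lemma mpvc_map_differentiable : differentiable F x.
Proof.
apply: differentiable_rV => k; case: (ixP k) => i.
- rewrite (_ : (fun _ => _) = fun y => eqc P y 0 i).
    by apply: differentiable_entry; case: (eqc_C1 P).
  by apply/funext => y; rewrite mpvc_map_pack packE.
- rewrite (_ : (fun _ => _) = fun y => ineqc P y 0 i).
    by apply: differentiable_entry; case: (ineqc_C1 P).
  by apply/funext => y; rewrite mpvc_map_pack packE.
- rewrite (_ : (fun _ => _) = - (fun y => vcH P y 0 i : R^o)).
    by apply: differentiableN; apply: differentiable_entry; case: (vcH_C1 P).
  by apply/funext => y; rewrite mpvc_map_pack packE.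
- rewrite (_ : (fun _ => _) = fun y => vcG P y 0 i).
    by apply: differentiable_entry; case: (vcG_C1 P).
  by apply/funext => y; rewrite mpvc_map_pack packE.
Qed.

Local Notation gradF k := (gradient (fun y => F y 0 k) x).

Lemma gradFE : [/\ forall i, gradF (ixh i) = gradient (fun y => eqc P y 0 i) x,
  forall i, gradF (ixg i) = gradient (fun y => ineqc P y 0 i) x,
  forall i, gradF (ixH i) = - gradient (fun y => vcH P y 0 i) x &
  forall i, gradF (ixG i) = gradient (fun y => vcG P y 0 i) x].
Proof.
split=> i; [| | rewrite -gradientN |];
  try by congr (gradient _ x); apply/funext => y; rewrite mpvc_map_pack packE.
by apply: differentiable_entry; case: (vcH_C1 P).
Qed.

Lemma mulmx_jacobianE u k : (u *m 'J F x) 0 k = inner (gradF k) u.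
Proof.
rewrite mxE; apply: eq_bigr => j _.
by rewrite jacobianE 1?mulrC//; exact: mpvc_map_differentiable.
Qed.

Lemma mulmx_jacobian_trE w : w *m ('J F x)^T = \sum_k w 0 k *: gradF k.
Proof.
apply/rowP => j; rewrite mxE summxE; apply: eq_bigr => k _.
rewrite [in RHS]mxE [in LHS]mxE jacobianE//; exact: mpvc_map_differentiable.
Qed.

(** The constraint space carries -H_i where a multiplier weighs H_i with a minus
    sign, so the multiplier of H enters with its own sign. *)
Definition mult_row l : 'rV[R]_(mE + (mI + mV * 2)) :=
  pack (mult_h l 0) (mult_g l 0) (mult_H l 0) (mult_G l 0).

Lemma gradient_combE l : gradient_comb P x l = mult_row l *m ('J F x)^T.
Proof.
rewrite mulmx_jacobian_trE sum_ix /mult_row.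
have [Fh Fg FH FG] := gradFE.
congr (_ + _ + _); apply: eq_bigr => i _; rewrite !packE ?Fh ?Fg//.
by rewrite FH FG scalerN addrC.
Qed.

(** Termwise, y -> <mult_row l, y> is maximal at F x among the y in D close to
    it.  At an index with H_i = 0 < G_i the G-coordinate stays positive, which
    pins the H-coordinate to 0 and leaves its multiplier free; at one with
    H_i > 0 = G_i the H-coordinate stays negative, which makes the G-coordinate
    nonpositive. *)
Lemma regular_normal_mult_row l : feasible P x -> RVC P x l ->
  (forall i, i \in Ig P x -> 0 <= mult_g l 0 i) ->
  (forall i, i \in I0m P x -> 0 <= mult_H l 0 i) ->
  (forall i, i \in Ip0 P x -> 0 <= mult_G l 0 i) ->
  (forall i, i \in I00 P x -> 0 <= mult_H l 0 i /\ mult_G l 0 i = 0) ->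
  regular_normal_cone (mpvc_D mE mI mV) (F x) (mult_row l).
Proof.
move=> /feasibleP[h0 g0 H0 GH0] [lg lH lG] lg0 lH0 lG0 l00.
apply: regular_normal_of_local_max.
near=> y => /mpvc_D_E[yh yg yD].
have sgn : forall k, (F x 0 k < 0 -> y 0 k < 0) /\ (0 < F x 0 k -> 0 < y 0 k).
  by near: y; exact: near_coord_sign.
rewrite /inner !sum_ix; apply: lerD; first apply: lerD; apply: ler_sum => i _.
- by rewrite yh mpvc_map_pack packE h0.
- rewrite !mpvc_map_pack !packE.
  have [gi|/lg->] := boolP (i \in Ig P x); last first.
    by rewrite !mul0r.
  have := gi; rewrite inE => /eqP->; rewrite mulr0.
  by rewrite mulr_ge0_le0// lg0.
- rewrite !mpvc_map_pack !packE; have [/= yH yHG] := yD i.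
  have [_ sG] := sgn (ixG i); have [sH _] := sgn (ixH i).
  move: sG sH; rewrite !mpvc_map_pack !packE => sG sH.
  have := lH i; have := lG i; have := lH0 i; have := lG0 i; have := l00 i.
  rewrite !inE.
  have := H0 i; rewrite le_eqVlt => /orP[/eqP Hi|Hi].
    rewrite -Hi eqxx ltxx/=.
    case: ltgtP => Gi //=.
    + move=> _ _ /(_ isT) lHi /(_ isT)-> _.
      by rewrite oppr0 !(mulr0, mul0r, addr0) mulr_ge0_le0.
    + move=> _ _ _ /(_ isT)-> _.
      have yG := sG Gi.
      have -> : y 0 (ixH i) = 0.
        by apply/eqP; rewrite eq_le yH -(pmulr_lge0 _ yG).
      by rewrite oppr0 !(mulr0, mul0r, addr0).
    + move=> /(_ isT)[lHi ->] _ _ _ _.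
      by rewrite oppr0 !(mulr0, mul0r, addr0) mulr_ge0_le0.
  rewrite gt_eqF// Hi /=.
  have yHn : y 0 (ixH i) < 0 by apply: sH; rewrite oppr_lt0.
  have yG : y 0 (ixG i) <= 0 by rewrite -(nmulr_rge0 _ yHn).
  move=> _ lGi _ lGn /(_ isT)->; rewrite !mul0r !add0r.
  have [Gi|Gi] := eqVneq (vcG P x 0 i) 0.
    by rewrite Gi mulr0 mulr_ge0_le0// lGi// Gi eqxx.
  by rewrite lGn ?mul0r// (negbTE Gi).
Unshelve. all: by end_near. Qed.

(** The polyhedral piece of the tangent cone of D attached to a partition of the
    biactive indices: {0} x R on b1 and R_- x R_- on b2.  Its members are
    feasible directions, since D is a union of polyhedra. *)
Lemma tangent_mpvc_D (b1 b2 : {set 'I_mV})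
    (d : 'rV[R]_(mE + (mI + mV * 2))) : feasible P x -> partition_I00 P x b1 b2 ->
  (forall i, d 0 (ixh i) = 0) ->
  (forall i, i \in Ig P x -> d 0 (ixg i) <= 0) ->
  (forall i, i \in (I0m P x :|: I00 P x :|: I0p P x)%SET -> d 0 (ixH i) <= 0) ->
  (forall i, i \in (I0p P x :|: b1)%SET -> 0 <= d 0 (ixH i)) ->
  (forall i, i \in (Ip0 P x :|: b2)%SET -> d 0 (ixG i) <= 0) ->
  tangent_cone (mpvc_D mE mI mV) (F x) d.
Proof.
move=> /feasibleP[h0 g0 H0 GH0] [_ b12] dh dg dHn dHp dG.
apply: tangent_feasible_direction.
near=> t.
have t0 : 0 < t by [].
have sgn k : F x 0 k < 0 -> (F x + t *: d) 0 k < 0.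
  by move: k; near: t; apply: filterS (near_ray_sign (F x) d) => t st k /(st k).1.
have sgn0 k : F x 0 k = 0 -> (F x + t *: d) 0 k = t * d 0 k.
  by rewrite !mxE => ->; rewrite add0r.
apply/mpvc_D_E; split=> i.
- by rewrite sgn0 ?dh ?mulr0// mpvc_map_pack packE.
- have := g0 i; rewrite le_eqVlt => /orP[/eqP gi|gi].
    by rewrite sgn0 ?mpvc_map_pack ?packE// pmulr_rle0// dg// inE gi.
  by apply: ltW; apply: sgn; rewrite mpvc_map_pack packE.
rewrite /DV /=.
have := H0 i; rewrite le_eqVlt => /orP[/eqP Hi|Hi].
  have FH0 : F x 0 (ixH i) = 0 by rewrite mpvc_map_pack packE -Hi oppr0.
  rewrite !(sgn0 (ixH i))//.
  have dHi : d 0 (ixH i) <= 0.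
    by apply: dHn; rewrite !inE -Hi eqxx/=; case: ltgtP.
  split; first by rewrite pmulr_rle0.
  have [Gi|Gi|Gi] := ltgtP (vcG P x 0 i) 0.
  + apply: mulr_le0; first by rewrite pmulr_rle0.
    by apply: ltW; apply: sgn; rewrite mpvc_map_pack packE.
  + have -> : d 0 (ixH i) = 0; last by rewrite mulr0 mul0r.
    by apply/eqP; rewrite eq_le dHi dHp// !inE -Hi eqxx Gi.
  + have : i \in I00 P x by rewrite inE -Hi Gi eqxx.
    rewrite -b12 inE => /orP[ib|ib].
      have -> : d 0 (ixH i) = 0; last by rewrite mulr0 mul0r.
      by apply/eqP; rewrite eq_le dHi dHp// inE ib orbT.
    rewrite sgn0 ?mpvc_map_pack ?packE//; apply: mulr_le0; rewrite pmulr_rle0//.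
    by apply: dG; rewrite inE ib orbT.
have yH : (F x + t *: d) 0 (ixH i) < 0.
  by apply: sgn; rewrite mpvc_map_pack packE oppr_lt0.
split; first exact: ltW.
apply: mulr_le0; first exact: ltW.
have := GH0 i; rewrite pmulr_lle0// le_eqVlt => /orP[/eqP Gi|Gi].
  by rewrite sgn0 ?mpvc_map_pack ?packE// pmulr_rle0// dG// !inE Hi Gi eqxx.
by apply: ltW; apply: sgn; rewrite mpvc_map_pack packE.
Unshelve. all: by end_near. Qed.

(** A vector polar to the linearized cone is polar to the smaller polyhedral
    cone that b1 and b2 select, to which Farkas' lemma applies.  Only the signs
    that this one piece yields are recorded; the theorem combines two of them. *)
Lemma polar_linearized_cone (b1 b2 : {set 'I_mV}) v : feasible P x ->
  partition_I00 P x b1 b2 -> polar (linearized_cone P x) v ->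
  exists l, [/\ RVC P x l, v = gradient_comb P x l,
    [/\ forall i, i \in Ig P x -> 0 <= mult_g l 0 i,
        forall i, i \in I0m P x -> 0 <= mult_H l 0 i &
        forall i, i \in Ip0 P x -> 0 <= mult_G l 0 i],
    forall i, i \in b1 -> mult_G l 0 i = 0 &
    forall i, i \in b2 -> 0 <= mult_H l 0 i /\ 0 <= mult_G l 0 i].
Proof.
move=> fx b12 vL.
pose on_h (i : 'I_mE) := true.
pose le_g := mem (Ig P x).
pose le_H := mem (I0m P x :|: I00 P x :|: I0p P x)%SET.
pose le_G := mem (Ip0 P x :|: b2)%SET.
pose ge_g (i : 'I_mI) := false.
pose ge_H := mem (I0p P x :|: b1)%SET.
pose ge_G (i : 'I_mV) := false.
have [|l [lq lp vE]] := @farkas_mixed _ _ _ (pack on_h le_g le_H le_G 0)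
  (pack on_h ge_g ge_H ge_G 0) (fun k => gradF k) v.
  move=> u pu qu; apply: vL; rewrite /linearized_cone /=.
  apply: (tangent_mpvc_D fx b12) => i.
  - rewrite mulmx_jacobianE; apply/eqP.
    by rewrite eq_le pu ?packE// qu// packE.
  - by move=> gi; rewrite mulmx_jacobianE pu// packE.
  - by move=> gi; rewrite mulmx_jacobianE pu// packE.
  - by move=> gi; rewrite mulmx_jacobianE qu// packE.
  - by move=> gi; rewrite mulmx_jacobianE pu// packE.
pose L : mult := Multiplier (\row_i l (ixh i)) (\row_i l (ixg i))
  (\row_i l (ixH i)) (\row_i l (ixG i)).
have LE : mult_row L = \row_k l k.
  apply/rowP => k; rewrite mxE.
  by rewrite /mult_row; case: (ixP k) => i; rewrite packE mxE.
exists L.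
(* A coordinate left unconstrained by the piece carries a zero multiplier; this
   gives membership in R_VC as well as l_G = 0 on b1. *)
have l0 k : ~~ pack on_h le_g le_H le_G 0 k -> ~~ pack on_h ge_g ge_H ge_G 0 k ->
    l k = 0.
  by move=> pk qk; apply/eqP; rewrite eq_le lp ?lq.
have [b0 b12E] := b12.
have b1_00 i : i \in b1 -> i \in I00 P x by rewrite -b12E inE => ->.
have b2_00 i : i \in b2 -> i \in I00 P x by rewrite -b12E inE orbC => ->.
have b1_2 i : i \in b1 -> i \notin b2.
  move=> ib1; apply/negP => ib2; have := finset.in_set0 i.
  by rewrite -b0 inE ib1 ib2.
split.
- split=> i iN; rewrite mxE; apply: l0.
  + by rewrite packE.
  + by rewrite packE.
  + by rewrite packE.
  + rewrite packE; apply: contra iN.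
    rewrite /ge_H /= !finset.in_setU => /orP[->|/b1_00->].
      by rewrite orbT.
    by rewrite orbT.
  + rewrite packE; apply: contra iN.
    rewrite /le_G /= !finset.in_setU => /orP[->//|/b2_00->].
    by rewrite orbT.
  + by rewrite packE.
- rewrite gradient_combE LE mulmx_jacobian_trE vE.
  by apply: eq_bigr => k _; rewrite mxE.
- split=> i gi; rewrite mxE; apply: lq.
  + by rewrite packE.
  + rewrite packE /ge_H /= finset.in_setU negb_or.
    move: (gi); rewrite inE => /andP[Hi Gi].
    rewrite inE Hi ltNge ltW//=; apply/negP => /b1_00.
    by rewrite inE Hi lt_eqF.
  + by rewrite packE.
- move=> i ib; rewrite mxE; apply: l0; last by rewrite packE.
  rewrite packE /le_G /= finset.in_setU negb_or b1_2// andbT inE.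
  by have := b1_00 i ib; rewrite inE => /andP[/eqP-> _]; rewrite ltxx.
- move=> i ib; rewrite !mxE; split; apply: lq; last by rewrite packE.
  rewrite packE /ge_H /= finset.in_setU negb_or inE.
  have -> : i \notin b1 by apply: contraL ib; exact: b1_2.
  by have := b2_00 i ib; rewrite inE => /andP[_ /eqP->]; rewrite ltxx andbF.
Qed.

Definition mult_sub l mu : mult :=
  Multiplier (mult_h l - mult_h mu) (mult_g l - mult_g mu)
    (mult_H l - mult_H mu) (mult_G l - mult_G mu).

Lemma gradient_comb_sub l mu :
  gradient_comb P x (mult_sub l mu) = gradient_comb P x l - gradient_comb P x mu.
Proof.
rewrite !gradient_combE -mulmxBl; congr (_ *m _); apply/rowP => k.
rewrite /mult_row [RHS]mxE [X in _ + X]mxE.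
by case: (ixP k) => i; rewrite !packE !mxE.
Qed.

End Mpvc.

Theorem theorem7 (R : realType) (n mE mI mV : nat) (P : mpvc R n mE mI mV)
  (x : 'rV[R]_n) (beta1 beta2 : {set 'I_mV})
  (x_feasible : feasible P x)
  (ggcq : GGCQ P x)
  (beta_partition : partition_I00 P x beta1 beta2)
  (hyp : forall mu : multiplier R mE mI mV, NVC P x mu ->
     (forall i, i \in beta1 -> mult_G mu 0 i <= 0) /\
     (forall i, i \in beta2 -> 0 <= mult_G mu 0 i) ->
     (forall i, i \in beta1 -> 0 <= mult_H mu 0 i) /\
     (forall i, i \in beta2 -> mult_G mu 0 i = 0)) :
  regular_normal_cone (feasible P) x = MVC P x beta1 beta2 /\
  MVC P x beta1 beta2 =
    (fun w => w *m ('J (mpvc_map P) x)^T) @`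
      regular_normal_cone (mpvc_D mE mI mV) (mpvc_map P x).
Proof.
pose S := (fun w => w *m ('J (mpvc_map P) x)^T) @`
  regular_normal_cone (mpvc_D mE mI mV) (mpvc_map P x).
have NM : regular_normal_cone (feasible P) x `<=` MVC P x beta1 beta2.
  rewrite /regular_normal_cone ggcq => v vL.
  have beta_swap : partition_I00 P x beta2 beta1.
    case: beta_partition => b0 b12.
    by rewrite /partition_I00 finset.setIC finset.setUC.
  have [l [lR vl [lg lH lG] l1 l2]] :=
    polar_linearized_cone x_feasible beta_partition vL.
  have [k [kR vk [kg kH kG] k2 k1]] :=
    polar_linearized_cone x_feasible beta_swap vL.
  exists l; last by rewrite -vl.
  (* On beta1 the multiplier k lies in the polar of the quadrant, on beta2 in that
     of the line, opposite to l. *)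
  split=> //; exists (mult_sub l k).
    split; last by rewrite gradient_comb_sub -vl -vk subrr.
    case: lR kR => lRg lRH lRG [kRg kRH kRG].
    by split=> i iN; rewrite !mxE ?(lRg, kRg, lRH, kRH, lRG, kRG)// subrr.
  split=> i ib; rewrite /= !mxE.
  - by rewrite ge_max gerBl kg ?lg.
  - by rewrite ge_max gerBl kH ?lH.
  - by rewrite ge_max gerBl kG ?lG.
  - by have [kHi kGi] := k1 i ib; rewrite !gerBl l1.
  - by have [lHi lGi] := l2 i ib; rewrite k2// subr0.
have MS : MVC P x beta1 beta2 `<=` S.
  move=> _ [l [lR [mu muN [lg lH lG l1 l2]]] <-].
  have [muH muG] : (forall i, i \in beta1 -> 0 <= mult_H mu 0 i) /\
      (forall i, i \in beta2 -> mult_G mu 0 i = 0).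
    apply: hyp => //; split=> i ib; last by case: (l2 i ib).
    by have [_ + <-] := l1 i ib.
  exists (mult_row l); last by rewrite gradient_combE.
  apply: regular_normal_mult_row => // i ii.
  - by have := lg i ii; rewrite ge_max => /andP[].
  - by have := lH i ii; rewrite ge_max => /andP[].
  - by have := lG i ii; rewrite ge_max => /andP[].
  have [_ b12] := beta_partition.
  move: ii; rewrite -b12 inE => /orP[ib|ib].
    by have [mlH _ ->] := l1 i ib; split=> //; apply: le_trans mlH; exact: muH.
  by have [? -> _] := l2 i ib; rewrite muG.
have SN : S `<=` regular_normal_cone (feasible P) x.
  rewrite /regular_normal_cone ggcq => _ [w wN <-] u uL.
  by rewrite inner_mulmx_tr; exact: wN.
have MS' : MVC P x beta1 beta2 = S.
  by apply/seteqP; split=> // v /SN/NM.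
split=> //; apply/seteqP; split=> //.
by move=> v /MS/SN.
Qed.
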